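(* Let $Z_1=V_2/V_1$, $Z_2=X_{a_1}/V_1$, let $Y\sim \mathrm{Gamma}(b-a+2,1)$ and let $\beta_1$ be the unique solution of $E L'(Y\beta_1)=0$. If $\beta_1<c_{01}$, then the estimator $$\delta_{1S2}=\begin{cases}\min\{c_{01},\ \beta_1(1+Z_1+(n_1-a_1+1)Z_2)\}V_1, & Z_1>0,\ Z_2>0,\\ c_{01}V_1, & \text{otherwise,}\end{cases}$$ of $\sigma_1$ dominates $\delta_{01}=c_{01}V_1$ under the scale invariant loss $L$.
   Context: Fix integers $1\le a_i<b_i\le n_i$, $i=1,2$, and put $a=a_1+a_2$, $b=b_1+b_2$. The unknown parameter is $\theta=(\mu_1,\mu_2,\sigma_1,\sigma_2)$ with $\mu_1,\mu_2\in\mathbb{R}$ and $0<\sigma_1\le\sigma_2$. From a random sample of size $n_i$ from the exponential distribution with density $\sigma_i^{-1}e^{-(x-\mu_i)/\sigma_i}$, $x>\mu_i$, one observes only the order statistics of ranks $a_i,\dots,b_i$ (doubly type-II censored sample). A complete sufficient statistic is $(X_{a_1},X_{a_2},V_1,V_2)$, consisting of four independent random variables, where $X_{a_i}$ has density $$\frac{n_i!}{(a_i-1)!(n_i-a_i)!}\Big[1-e^{-\frac{x-\mu_i}{\sigma_i}}\Big]^{a_i-1}\frac1{\sigma_i}\Big[e^{-\frac{x-\mu_i}{\sigma_i}}\Big]^{n_i-a_i+1},\quad x>\mu_i,$$ and $V_i$ has the gamma distribution with shape $b_i-a_i$ and scale $\sigma_i$. $\mathrm{Gamma}(k,1)$ denotes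 the gamma distribution with shape $k$ and scale $1$. The loss for estimating $\sigma_1$ by $\delta$ is $L(\delta/\sigma_1)$, where $L$ is differentiable and: (i) $L(t)$ is bowl-shaped with minimum value $0$ attained at $t=1$, decreasing for $t\le1$ and increasing for $t\ge1$; (ii) all integrals involving $L$ are finite and differentiation under the integral sign is permissible. The risk is $R(\theta,\delta)=E_\theta L(\delta/\sigma_1)$. An estimator $\delta$ dominates $\delta'$ if $R(\theta,\delta)\le R(\theta,\delta')$ for all $\theta$, with strict inequality for at least one $\theta$. The best affine equivariant estimator (BAEE) of $\sigma_1$ is $\delta_{01}=c_{01}V_1$, where $c_{01}$ is the unique solution of $E_{\sigma_1=1}\big(L'(c_{01}V_1)V_1\big)=0$. *)

(* Defs.v *)
From HB Require Import structures.
From mathcomp Require Import all_boot all_order all_algebra.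
From mathcomp Require Import all_classical all_reals all_analysis.

Set Implicit Arguments.
Unset Strict Implicit.
Unset Printing Implicit Defensive.

Import Order.TTheory GRing.Theory Num.Theory.
Import numFieldNormedType.Exports.

Local Open Scope classical_set_scope.
Local Open Scope ring_scope.

Record param (R : realType) := Param {
  loc1 : R;
  loc2 : R;
  scale1 : R;
  scale2 : R }.

Definition admissible (R : realType) (theta : param R) : Prop :=
  0 < scale1 theta <= scale2 theta.

(* The rank-a order statistic of a sample of size n from the exponential
   distribution with location m and scale s. *)
Definition exp_order_stat_pdf (R : realType) (n a : nat) (m s x : R) : R :=
  if m < x then
    n`!%:R / ((a.-1)`!%:R * (n - a)`!%:R)
      * (1 - expR (- ((x - m) / s))) ^+ a.-1
      * s^-1 * expR (- ((x - m) / s)) ^+ (n - a + 1)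
  else 0.

(* Only positive integer shapes k occur, so that Gamma(k) = (k - 1)!. *)
Definition gamma_pdf (R : realType) (k : nat) (s x : R) : R :=
  if 0 < x then x ^+ k.-1 * expR (- (x / s)) / ((k.-1)`!%:R * s ^+ k) else 0.

(* E g(Y) for Y ~ Gamma(k, s); g is only evaluated on the positive reals. *)
Definition gamma_expectation (R : realType) (k : nat) (s : R) (g : R -> R) :
    \bar R :=
  (\int[lebesgue_measure]_(y in `]0%R, +oo[) (g y * gamma_pdf k s y)%:E)%E.

Definition has_pdf (d : measure_display) (T : measurableType d) (R : realType)
    (P : probability T R) (X : {mfun T >-> R}) (f : R -> R) : Prop :=
  forall A : set R, measurable A ->
    distribution P X A = (\int[lebesgue_measure]_(x in A) (f x)%:E)%E.

Definition independent4 (d : measure_display) (T : measurableType d)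
    (R : realType) (P : probability T R) (X1 X2 X3 X4 : {mfun T >-> R}) : Prop :=
  forall A1 A2 A3 A4 : set R,
    measurable A1 -> measurable A2 -> measurable A3 -> measurable A4 ->
    P (X1 @^-1` A1 `&` X2 @^-1` A2 `&` X3 @^-1` A3 `&` X4 @^-1` A4) =
    (P (X1 @^-1` A1) * P (X2 @^-1` A2) * P (X3 @^-1` A3) * P (X4 @^-1` A4))%E.

(* The joint law, for every value of the parameter, of the complete sufficient
   statistic (X1, X2, V1, V2) of two doubly type-II censored samples. *)
Definition censored_model (d : measure_display) (T : measurableType d)
    (R : realType) (a1 b1 n1 a2 b2 n2 : nat) (P : param R -> probability T R)
    (X1 X2 V1 V2 : {mfun T >-> R}) : Prop :=
  forall theta : param R, admissible theta ->
  [/\ independent4 (P theta) X1 X2 V1 V2,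
      has_pdf (P theta) X1
        (exp_order_stat_pdf n1 a1 (loc1 theta) (scale1 theta)),
      has_pdf (P theta) X2
        (exp_order_stat_pdf n2 a2 (loc2 theta) (scale2 theta)),
      has_pdf (P theta) V1 (gamma_pdf (b1 - a1) (scale1 theta))
    & has_pdf (P theta) V2 (gamma_pdf (b2 - a2) (scale2 theta))].

(* A loss is a function of the ratio delta / sigma_1 > 0, so L is constrained
   on the positive reals only (e.g. L t = t - ln t - 1 is allowed). *)
Definition bowl_shaped_loss (R : realType) (L : R -> R) : Prop :=
  [/\ forall t : R, 0 < t -> derivable L t 1,
      L 1 = 0,
      forall s t : R, 0 < s -> s <= t -> t <= 1 -> L t <= L s
    & forall s t : R, 1 <= s -> s <= t -> L s <= L t].

(* c |-> \int_0^oo L (c v / s) f v dv is finite and can be differentiated under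
   the integral sign, the differentiated integral being finite as well. *)
Definition diff_under_integral (R : realType) (L : R -> R) (s : R) (f : R -> R) :
    Prop :=
  forall c : R, 0 < c ->
  [/\ lebesgue_measure.-integrable `]0, +oo[
        (fun v : R => (L (c * v / s) * f v)%:E),
      lebesgue_measure.-integrable `]0, +oo[
        (fun v : R => (derive1 L (c * v / s) * (v / s) * f v)%:E)
    & is_derive c 1
        (fun c' : R =>
           (\int[lebesgue_measure]_(v in `]0, +oo[) (L (c' * v / s) * f v))%R)
        (\int[lebesgue_measure]_(v in `]0, +oo[)
           (derive1 L (c * v / s) * (v / s) * f v))%R].

(* The joint density of (V1, V2 / V1, X1 / V1) at (v, z1, z2), v > 0: the
   change of variables (x1, v1, v2) = (z2 v, v, z1 v) has Jacobian v ^ 2.  As a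
   function of v it is, up to normalization, the density of V1 given
   V2 / V1 = z1 and X1 / V1 = z2. *)
Definition ratio_pdf (R : realType) (a1 b1 n1 a2 b2 : nat) (theta : param R)
    (z1 z2 v : R) : R :=
  v ^+ 2 * exp_order_stat_pdf n1 a1 (loc1 theta) (scale1 theta) (z2 * v)
    * gamma_pdf (b1 - a1) (scale1 theta) v
    * gamma_pdf (b2 - a2) (scale2 theta) (z1 * v).

(* The integrals involving L are the risks of the estimators c V1, their
   conditional risks given the two ratios (both differentiated in c), and the
   expectations under Gamma(b - a + 2, 1). *)
Definition regular_loss (R : realType) (a1 b1 n1 a2 b2 : nat) (L : R -> R) :
    Prop :=
  [/\ forall theta : param R, admissible theta ->
        diff_under_integral L (scale1 theta)
          (gamma_pdf (b1 - a1) (scale1 theta)),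
      forall (theta : param R) (z1 z2 : R), admissible theta ->
        0 < z1 -> 0 < z2 ->
        diff_under_integral L (scale1 theta)
          (ratio_pdf a1 b1 n1 a2 b2 theta z1 z2)
    & forall beta : R, 0 < beta ->
        lebesgue_measure.-integrable `]0, +oo[ (fun y : R =>
          (derive1 L (y * beta)
             * gamma_pdf ((b1 + b2) - (a1 + a2) + 2) 1 y)%:E)].

(* c01 is the unique c with E_{sigma_1 = 1} (L'(c V1) V1) = 0. *)
Definition is_baee_const (R : realType) (a1 b1 : nat) (L : R -> R) (c01 : R) :
    Prop :=
  unique (fun c : R => 0 < c /\
    gamma_expectation (b1 - a1) 1 (fun v => derive1 L (c * v) * v) = 0%E) c01.

Definition is_stein_const (R : realType) (a1 b1 a2 b2 : nat) (L : R -> R)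
    (beta1 : R) : Prop :=
  unique (fun beta : R => 0 < beta /\
    gamma_expectation ((b1 + b2) - (a1 + a2) + 2) 1
      (fun y => derive1 L (y * beta)) = 0%E) beta1.

Definition baee (T : Type) (R : realType) (c01 : R) (V1 : T -> R) (w : T) : R :=
  c01 * V1 w.

Definition delta_1S2 (T : Type) (R : realType) (n1 a1 : nat) (c01 beta1 : R)
    (X1 V1 V2 : T -> R) (w : T) : R :=
  let Z1 := V2 w / V1 w in
  let Z2 := X1 w / V1 w in
  if (0 < Z1) && (0 < Z2) then
    Num.min c01 (beta1 * (1 + Z1 + (n1 - a1 + 1)%:R * Z2)) * V1 w
  else c01 * V1 w.

Definition risk (d : measure_display) (T : measurableType d) (R : realType)
    (P : param R -> probability T R) (L : R -> R) (theta : param R)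
    (delta : T -> R) : \bar R :=
  ('E_(P theta)[fun w => (L (delta w / scale1 theta))%R])%E.

Definition dominates (d : measure_display) (T : measurableType d)
    (R : realType) (P : param R -> probability T R) (L : R -> R)
    (delta delta' : T -> R) : Prop :=
  (forall theta : param R, admissible theta ->
     (risk P L theta delta <= risk P L theta delta')%E) /\
  (exists theta : param R, admissible theta /\
     (risk P L theta delta < risk P L theta delta')%E).

(* Main.v *)
From HB Require Import structures.
Require Import Defs.
From mathcomp Require Import all_boot all_order all_algebra.
From mathcomp Require Import all_classical all_reals all_analysis.
From mathcomp Require Import measurable_realfun.
From mathcomp Require Import zify ring.

(* Stein's argument.  Given the ratios Z1 = z1 > 0 and Z2 = z2 > 0, the risk
   of c V1 is r(c) = int L(c v / s) h(v) dv, where s = sigma_1 and h is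
   ratio_pdf.  Put W = 1 + z1 + (n1 - a1 + 1) z2.  Then v h(v) is a
   nondecreasing weight times the Gamma(b - a + 2, s / W) density, and
   L'(c v / s) changes sign once, from - to +, at v = s / c; hence r'(c) is at
   least a nonnegative multiple of E L'(Y c / W).  A second use of the single
   sign change, with the gamma densities of scales c / W and beta_1, shows that
   this expectation is nonnegative for c >= beta_1 W, and positive for
   c > beta_1 W since beta_1 is the only root.  So r increases on
   [beta_1 W, c01].  The joint law of (Z2, Z1, V1) turns this into the
   comparison of risks, which is strict at mu_1 = 0, where the weight does not
   vanish at v = s / c, because beta_1 W < c01 for small z1 and z2. *)

Set Implicit Arguments.
Unset Strict Implicit.
Unset Printing Implicit Defensive.

Import Order.TTheory GRing.Theory Num.Theory.
Import numFieldNormedType.Exports.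

Local Open Scope classical_set_scope.
Local Open Scope ring_scope.
Local Open Scope ereal_scope.

(** * Integrals of nonnegative functions: null sets, densities, strict comparison *)

Section measure_facts.
Context d (T : measurableType d) (R : realType).
Variable m : {measure set T -> \bar R}.

Import HBNNSimple.

(** No measurability of [f] or [g] is assumed, so the integrals are handled as suprema over simple
    functions: multiplying a simple function below [f] by the indicator of the complement of [N]
    puts it below [g] without changing its integral. *)
Let le_ge0_integral_off_null (N : set T) (f g : T -> \bar R) :
  measurable N -> m N = 0 -> (forall x, 0 <= f x) -> (forall x, 0 <= g x) ->
  (forall x, ~ N x -> f x = g x) ->
  \int[m]_x f x <= \int[m]_x g x.
Proof.
move=> mN N0 f0 g0 fg.
rewrite !ge0_integralTE//.
apply: ge_ereal_sup => /= _ [h hf <-].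
apply: ereal_sup_ubound => /=.
exists (proj_nnsfun h (measurableC mN)) => [x|].
  rewrite /= mindicE; case: (boolP (x \in ~` N)) => [|_].
    by rewrite inE => Nx; rewrite mulr1 -fg//; exact: hf.
  by rewrite mulr0.
rewrite -!integralT_nnsfun.
apply: (ge0_ae_eq_integral measurableT) => //.
- exact/measurable_EFinP.
- exact/measurable_EFinP.
- by move=> x _; rewrite lee_fin.
- by move=> x _; rewrite lee_fin.
exists N; split => // x /= /not_implyP[_]; apply: contra_notP => Nx.
by rewrite /= mindicE mem_set// mulr1.
Qed.

(* The loss may fail to be measurable on the null set [V1 <= 0], where [L] is
   unconstrained. *)
Lemma eq_integral_off_null (N : set T) (f g : T -> \bar R) :
  measurable N -> m N = 0 -> (forall x, ~ N x -> f x = g x) ->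
  \int[m]_x f x = \int[m]_x g x.
Proof.
move=> mN N0 fg.
rewrite integralE [RHS]integralE.
by congr (_ - _); apply/eqP; rewrite eq_le; apply/andP; split;
  apply: (le_ge0_integral_off_null mN N0) => // x Nx;
  rewrite ?funeposE ?funenegE fg.
Qed.

(** For the indicator of a measurable set this is the hypothesis on [nu]; linearity gives it for
    simple functions, and monotone convergence on both sides gives it for [f]. *)
Lemma ge0_integral_density (nu : {measure set T -> \bar R}) (p : T -> R) :
  measurable_fun setT p -> (forall x, 0 <= p x)%R ->
  (forall A, measurable A -> nu A = \int[m]_(x in A) (p x)%:E) ->
  forall f : T -> \bar R, measurable_fun setT f -> (forall x, 0 <= f x) ->
  \int[nu]_x f x = \int[m]_x (f x * (p x)%:E).
Proof.
move=> mp p0 nuE f mf f0.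
pose h := nnsfun_approx measurableT mf.
have mpE : measurable_fun setT (fun x => (p x)%:E) by exact/measurable_EFinP.
have -> : \int[nu]_x f x = limn (fun n => \int[nu]_x (h n x)%:E).
  rewrite -monotone_convergence//.
  - apply: eq_integral => x _; apply/esym/cvg_lim => //.
    exact: cvg_nnsfun_approx.
  - by move=> n; exact/measurable_EFinP.
  - by move=> n x _; rewrite lee_fin.
  - by move=> x _ a b ab; rewrite lee_fin; exact/lefP/nd_nnsfun_approx.
have -> : \int[m]_x (f x * (p x)%:E) =
    limn (fun n => \int[m]_x ((h n x)%:E * (p x)%:E)).
  rewrite -monotone_convergence//.
  - apply: eq_integral => x _; apply/esym/cvg_lim => //.
    by apply: cvgeZr => //; exact: cvg_nnsfun_approx.
  - by move=> n; apply: emeasurable_funM => //; exact/measurable_EFinP.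
  - by move=> n x _; rewrite mule_ge0// lee_fin.
  - move=> x _ a b ab; rewrite lee_wpmul2r ?lee_fin//.
    exact/lefP/nd_nnsfun_approx.
congr (limn _); apply/funext => n.
rewrite integralT_nnsfun sintegralE.
transitivity (\int[m]_x (\sum_(y \in range (h n))
    (y%:E * ((\1_(h n @^-1` [set y]) x)%:E * (p x)%:E)))).
  rewrite ge0_integral_fsum//.
  - apply: eq_fsbigr => y /[!inE] -[t _ hy].
    rewrite ge0_integralZl//; last 3 first.
    + apply: emeasurable_funM => //; apply/measurable_EFinP.
      exact: measurable_indic.
    + by move=> x _; rewrite mule_ge0// lee_fin.
    + by rewrite lee_fin -hy.
    rewrite nuE// integral_mkcond; congr (_ * _); apply: eq_integral => x _.
    by rewrite patchE indicE; case: ifPn => _; rewrite ?mul1e ?mul0e.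
  - move=> y; apply: measurable_funeM.
    apply: emeasurable_funM => //; apply/measurable_EFinP.
    exact: measurable_indic.
  - move=> y x _; rewrite muleA mule_ge0 ?lee_fin//.
    exact: nnfun_muleindic_ge0.
apply: eq_integral => x _.
under eq_fsbigr do rewrite muleA.
rewrite -ge0_mule_fsuml; last by move=> y; exact: nnfun_muleindic_ge0.
by rewrite fsumEFin// -fimfunE.
Qed.

(** Equality of the integrals would make the nonnegative function [g \- f] integrate to 0, hence
    vanish almost everywhere, against strictness on the non-null set [B]. *)
Lemma lt_ge0_integral (f g : T -> \bar R) (B : set T) :
  measurable_fun setT f -> measurable_fun setT g ->
  (forall x, 0 <= f x) -> (forall x, f x <= g x) ->
  (forall x, f x \is a fin_num) ->
  \int[m]_x g x < +oo ->
  measurable B -> m B != 0 -> (forall x, B x -> f x < g x) ->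
  \int[m]_x f x < \int[m]_x g x.
Proof.
move=> mf mg f0 fg ffin goo mB mB0 fgB.
have g0 x : 0 <= g x by exact: le_trans (fg x).
rewrite lt_neqAle ge0_le_integral// andbT; apply/eqP => fgE.
have fi : m.-integrable setT f.
  apply/integrableP; split=> //; under eq_integral do rewrite gee0_abs//.
  by rewrite fgE.
have gi : m.-integrable setT g.
  by apply/integrableP; split=> //; under eq_integral do rewrite gee0_abs//.
have gfi := integrableB measurableT gi fi.
have gf0 : \int[m]_x (g \- f) x = 0.
  rewrite integralB// fgE subee//.
  by rewrite ge0_fin_numE// integral_ge0.
have : \int[m]_x `|(g \- f) x| = 0.
  rewrite -[RHS]gf0; apply: eq_integral => x _; rewrite gee0_abs//=.
  by rewrite sube_ge0 ?ffin//.
move/(ae_eq_integral_abs _ measurableT (measurable_int _ gfi)).1.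
move=> [N [mN N0 sN]].
move/eqP: mB0; apply.
apply: (subset_measure0 mB mN _ N0) => x Bx; apply: sN => /= /(_ I).
by apply/eqP; rewrite gt_eqF//= sube_gt0; exact: fgB.
Qed.

End measure_facts.

(** * Sigma-finiteness of a product measure *)

Section product_sigma_finite.
Context d1 d2 (T1 : measurableType d1) (T2 : measurableType d2) (R : realType).
Variables (m1 : {sigma_finite_measure set T1 -> \bar R}).
Variables (m2 : {sigma_finite_measure set T2 -> \bar R}).

Let sigma_finite_prod : sigma_finite setT (m1 \x m2).
Proof.
have /sigma_finiteP[F [FT ndF Foo]] := sigma_finiteT m1.
have /sigma_finiteP[G [GT ndG Goo]] := sigma_finiteT m2.
(* Both exhaustions are increasing, so the diagonal products already cover the space: the index
   [maxn i j] serves every point. *)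
exists (fun n => F n `*` G n) => [|n].
  apply/seteqP; split => // -[x y] _.
  have [i _ Fi] : (\bigcup_i F i) x by rewrite -FT.
  have [j _ Gj] : (\bigcup_j G j) y by rewrite -GT.
  exists (maxn i j) => //; split.
  - exact: (subsetPset _ _ (ndF _ _ (leq_maxl i j))).
  - exact: (subsetPset _ _ (ndG _ _ (leq_maxr i j))).
have [mF Fn] := Foo n; have [mG Gn] := Goo n.
split; first exact: measurableX.
by rewrite product_measure1E// lte_mul_pinfty// ge0_fin_numE.
Qed.

(* The library makes [m1 \x m2] canonically sigma-finite for subprobabilities
   only. *)
Definition sigma_finite_product := m1 \x m2.

HB.instance Definition _ := Measure.on sigma_finite_product.

HB.instance Definition _ := Measure_isSigmaFinite.Build _ _ _
  sigma_finite_product sigma_finite_prod.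

End product_sigma_finite.

(** * Integration against product laws, and independence *)

Section independence.
Context d (T : measurableType d) (R : realType) (P : probability T R).

(** Tonelli on both sides. Densities enter through integrals of nonnegative functions rather than
    through measures of sets, so that the conclusion has the form of the premises and the lemma can
    be iterated. *)
Lemma ge0_integral_density_prod d1 d2 (S1 : measurableType d1)
    (S2 : measurableType d2)
    (n1 m1 : {sigma_finite_measure set S1 -> \bar R})
    (n2 m2 : {sigma_finite_measure set S2 -> \bar R})
    (p1 : S1 -> R) (p2 : S2 -> R) :
  measurable_fun setT p1 -> (forall x, 0 <= p1 x)%R ->
  measurable_fun setT p2 -> (forall x, 0 <= p2 x)%R ->
  (forall f : S1 -> \bar R, measurable_fun setT f -> (forall x, 0 <= f x) ->
    \int[n1]_x f x = \int[m1]_x (f x * (p1 x)%:E)) ->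
  (forall f : S2 -> \bar R, measurable_fun setT f -> (forall x, 0 <= f x) ->
    \int[n2]_x f x = \int[m2]_x (f x * (p2 x)%:E)) ->
  forall f : S1 * S2 -> \bar R, measurable_fun setT f ->
    (forall x, 0 <= f x) ->
  \int[n1 \x n2]_z f z = \int[m1 \x m2]_z (f z * (p1 z.1 * p2 z.2)%:E).
Proof.
move=> mp1 p10 mp2 p20 n1E n2E f mf f0.
have mp2' : measurable_fun setT (fun z : S1 * S2 => (p2 z.2)%:E).
  exact/measurable_EFinP/(measurableT_comp mp2).
have mp1' : measurable_fun setT (fun z : S1 * S2 => (p1 z.1)%:E).
  exact/measurable_EFinP/(measurableT_comp mp1).
have mfx x : measurable_fun setT (fun y => f (x, y)).
  exact: measurableT_comp.
rewrite fubini_tonelli1// [RHS]fubini_tonelli1//=; last 2 first.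
- under eq_fun do rewrite EFinM.
  by do 2!apply: emeasurable_funM => //.
- by move=> z; rewrite mule_ge0// lee_fin mulr_ge0.
rewrite n1E; last 2 first.
- exact: measurable_fun_fubini_tonelli_F.
- by move=> x; exact: integral_ge0.
apply: eq_integral => x _.
rewrite /fubini_F n2E// -ge0_integralZr//; last 3 first.
- by apply: emeasurable_funM => //; exact/measurable_EFinP.
- by move=> y _; rewrite mule_ge0// lee_fin.
- by rewrite lee_fin.
by apply: eq_integral => y _ /=; rewrite EFinM -muleA (muleC (p2 y)%:E).
Qed.

(** Uniqueness of the product measure identifies the joint law, first that of [(X, Y)] on each event
    of [Z], then that of the triple. *)
Lemma ge0_integral_independent3 d1 d2 d3 (S1 : measurableType d1)
    (S2 : measurableType d2) (S3 : measurableType d3)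
    (X : {mfun T >-> S1}) (Y : {mfun T >-> S2}) (Z : {mfun T >-> S3}) :
  (forall A B C, measurable A -> measurable B -> measurable C ->
    P (X @^-1` A `&` Y @^-1` B `&` Z @^-1` C) =
    P (X @^-1` A) * P (Y @^-1` B) * P (Z @^-1` C)) ->
  forall f : S1 * S2 * S3 -> \bar R, measurable_fun setT f ->
    (forall x, 0 <= f x) ->
  \int[P]_w f (X w, Y w, Z w) =
  \int[distribution P X \x distribution P Y \x distribution P Z]_z f z.
Proof.
move=> ind f mf f0.
have mXY : measurable_fun setT (fun w => (X w, Y w)).
  exact: measurable_fun_pair.
have mXYZ : measurable_fun setT (fun w => (X w, Y w, Z w)).
  exact: measurable_fun_pair.
have indXYZ E C : measurable E -> measurable C ->
    P ((fun w => (X w, Y w)) @^-1` E `&` Z @^-1` C) =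
    (distribution P X \x distribution P Y) E * P (Z @^-1` C).
  move=> mE mC.
  have mZC : measurable (Z @^-1` C) by exact: measurable_funPTI.
  have r0 : (0 <= fine (P (Z @^-1` C)))%R by exact: fine_ge0.
  have rE : (fine (P (Z @^-1` C)))%:E = P (Z @^-1` C).
    by rewrite fineK// fin_num_measure.
  (* With the event [C] of [Z] fixed, the restricted law of [(X, Y)] and [r] times the product law
     both agree on rectangles with the product of the law of [X] and [r] times the law of [Y]; hence
     they coincide. *)
  pose r : {nonneg R} := NngNum r0.
  pose m' := measure_function_pushforward__canonical__measure_function_Measure
    (mrestr P mZC) mXY.
  have /= H1 := @product_measure_unique _ _ _ _ _ (distribution P X)
    (mscale r (distribution P Y)) m'.
  have H2 := @product_measure_unique _ _ _ _ _ (distribution P X)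
    (mscale r (distribution P Y))
    (mscale r (distribution P X \x distribution P Y)).
  have <- : pushforward (mrestr P mZC) (fun w => (X w, Y w)) E =
    P ((fun w => (X w, Y w)) @^-1` E `&` Z @^-1` C) by [].
  rewrite -H1//; last first.
    move=> A B mA mB.
    rewrite /pushforward /mrestr /mscale /= rE (muleC (P (Z @^-1` C))).
    by rewrite muleA -ind.
  rewrite H2//; last first.
    move=> A B mA mB.
    rewrite /mscale /=.
    transitivity (r%:num%:E * (distribution P X A * distribution P Y B)).
      congr (_ * _); exact: product_measure1E.
    by rewrite muleCA.
  by rewrite -rE muleC.
have QE : forall E, measurable E ->
    (distribution P X \x distribution P Y \x distribution P Z) E =
    pushforward P (fun w => (X w, Y w, Z w)) E.
  pose PXY : probability (S1 * S2)%type R :=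
    (distribution P X \x distribution P Y).
  apply: (@product_measure_unique _ _ _ _ _ PXY (distribution P Z)
    (measure_function_pushforward__canonical__measure_function_Measure P mXYZ)).
  move=> A B mA mB.
  transitivity ((distribution P X \x distribution P Y) A * P (Z @^-1` B)) => //.
  by rewrite -indXYZ.
rewrite (eq_measure_integral
  (pushforward P (fun w => (X w, Y w, Z w)))); last first.
  by move=> A mA _; exact: QE.
by rewrite ge0_integral_pushforward.
Qed.

End independence.

(** * Linear changes of variable in Lebesgue integrals *)

Section scaling.
Context (R : realType).
Local Notation mu := (@lebesgue_measure R).

(** [k] times the image of Lebesgue measure under multiplication by [k] gives each interval its
    length, so it is Lebesgue measure. *)
Lemma ge0_integral_scale (k : R) (f : R -> \bar R) : (0 < k)%R ->
  measurable_fun setT f -> (forall x, 0 <= f x) ->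
  \int[mu]_x f x = k%:E * \int[mu]_x f (k * x)%R.
Proof.
move=> k0 mf f0.
have mk : measurable_fun setT
    (fun x : measurableTypeR R => (k * x)%R : measurableTypeR R).
  exact: measurable_funM.
pose nu : {measure set (measurableTypeR R) -> \bar R} :=
  measure_function_pushforward__canonical__measure_function_Measure mu mk.
have -> : \int[mu]_x f x = \int[mscale (NngNum (ltW k0)) nu]_x f x.
  apply: eq_measure_integral => A mA _.
  apply: lebesgue_measure_unique => // _ [[a b]] _ <-.
  have kE : [eta *%R k] @^-1` `]a, b] = `](a / k)%R, (b / k)%R]%classic.
    apply/seteqP; split => x /=; rewrite !in_itv/= ltr_pdivrMr// ler_pdivlMr//;
    by rewrite mulrC.
  rewrite [X in _ = _ * mu X]kE.
  rewrite !lebesgue_measure_itv/= !lte_fin ltr_pM2r ?invr_gt0//.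
  case: ifPn => _; last by rewrite mule0.
  by rewrite -!EFinB -EFinM -mulrBl mulrC mulfVK ?gt_eqF.
rewrite ge0_integral_mscale//=; congr (_ * _).
by rewrite ge0_integral_pushforward.
Qed.

Lemma ge0_integral_scale2 (k : R) (f : R * R -> \bar R) : (0 < k)%R ->
  measurable_fun setT f -> (forall x, 0 <= f x) ->
  \int[mu \x mu]_z f z =
  \int[mu \x mu]_z ((k ^+ 2)%:E * f (k * z.1, k * z.2)%R).
Proof.
move=> k0 mf f0.
have mfk : measurable_fun setT (fun z : R * R => f (k * z.1, k * z.2)%R).
  apply: measurableT_comp => //.
  by apply: measurable_fun_pair; apply: measurable_funM.
rewrite ge0_integralZl//; last by rewrite lee_fin exprn_ge0// ltW.
rewrite fubini_tonelli1// [in RHS]fubini_tonelli1//.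
rewrite (ge0_integral_scale k0)//; last 2 first.
- exact: measurable_fun_fubini_tonelli_F.
- by move=> x; exact: integral_ge0.
rewrite expr2 EFinM -muleA; congr (_ * _).
rewrite -ge0_integralZl//; last 3 first.
- exact: measurable_fun_fubini_tonelli_F.
- by move=> x _; exact: integral_ge0.
- by rewrite lee_fin ltW.
apply: eq_integral => x _.
by rewrite /fubini_F/= (ge0_integral_scale k0)//; exact: measurableT_comp.
Qed.

Let patch_scale (k : R) (f : R -> \bar R) x : (0 < k)%R ->
  (f \_ `]0%R, +oo[) (k * x)%R = ((fun y => f (k * y)%R) \_ `]0%R, +oo[) x.
Proof.
move=> k0; rewrite !patchE !mem_setE !in_itv/= !andbT.
by rewrite pmulr_rgt0.
Qed.

Lemma integrable_scale (k : R) (f : R -> \bar R) : (0 < k)%R ->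
  mu.-integrable `]0%R, +oo[ f ->
  mu.-integrable `]0%R, +oo[ (fun x => f (k * x)%R).
Proof.
have mD : measurable (`]0%R, +oo[ : set R) by exact: measurable_itv.
move=> k0 fi.
have /integrableP[mf foo] := (integrable_mkcond (mu := mu) f mD).1 fi.
apply/(integrable_mkcond (mu := mu) _ mD); apply/integrableP.
have E : (fun y => f (k * y)%R) \_ `]0%R, +oo[ =
    (fun x => (f \_ `]0%R, +oo[) (k * x)%R).
  by apply/funext => x; rewrite patch_scale.
rewrite E; split.
  by apply: measurableT_comp => //; exact: measurable_funM.
move: foo; rewrite (ge0_integral_scale k0)//; last exact: measurableT_comp.
by rewrite -{1}(gt0_muley (x := k%:E)) ?lte_fin// lte_pmul2l.
Qed.

(** The signed version, needed because [derive1 L] changes sign: positive and negative parts are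
    scaled separately, and integrability lets [k] distribute over their difference. *)
Lemma integral_scale (k : R) (f : R -> \bar R) : (0 < k)%R ->
  mu.-integrable `]0%R, +oo[ f ->
  \int[mu]_(x in `]0%R, +oo[) f x =
  k%:E * \int[mu]_(x in `]0%R, +oo[) f (k * x)%R.
Proof.
move=> k0 fi.
have mf := measurable_int _ fi.
have mD : measurable (`]0%R, +oo[ : set R) by exact: measurable_itv.
have fki := integrable_scale k0 fi.
rewrite integralE [in RHS]integralE muleBr//; last first.
  apply: fin_num_adde_defl; rewrite fin_numN.
  exact: (@integrable_neg_fin_num _ _ _ mu _ mD _ fki).
have H (g : R -> \bar R) : measurable_fun (`]0%R, +oo[ : set R) g ->
    (forall x, 0 <= g x) ->
    \int[mu]_(x in `]0%R, +oo[) g x =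
    k%:E * \int[mu]_(x in `]0%R, +oo[) g (k * x)%R.
  move=> mg g0.
  rewrite integral_mkcond (ge0_integral_scale k0).
  - rewrite [in RHS]integral_mkcond; congr (_ * _); apply: eq_integral => x _.
    by rewrite patch_scale.
  - exact/(measurable_restrictT _ _).1.
  - by move=> x; rewrite patchE; case: ifP.
congr (_ - _).
- rewrite H//; last exact: measurable_funepos.
  by congr (_ * _); apply: eq_integral => x _; rewrite !funeposE.
- rewrite H//; last exact: measurable_funeneg.
  by congr (_ * _); apply: eq_integral => x _; rewrite !funenegE.
Qed.

End scaling.

(** * Signs of a bowl-shaped loss and of its derivative *)

Section monotone_derivative.
Context (R : realType).
Local Open Scope ring_scope.

(** Adding [e] times the identity makes [f] strictly increasing, so its derivative plus [e] is
    nonnegative for every [e > 0]. *)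
Lemma nondecreasing_derive1_ge0 (f : R -> R) (a b z : R) :
  {in `]a, b[, forall x, derivable f x 1} ->
  {in `]a, b[ &, {homo f : x y / x <= y}} ->
  z \in `]a, b[ -> 0 <= derive1 f z.
Proof.
move=> df fh zab; apply/ler_addgt0Pr => e e0.
have dg x : x \in `]a, b[ -> derivable (f + e *: @idfun R) x 1.
  by move=> xab; apply: derivableD; [exact: df|exact: derivableZ].
have <- : derive1 (f + e *: @idfun R) z = derive1 f z + e.
  rewrite !derive1E deriveD; [|exact: df|exact: derivableZ].
  by rewrite deriveZ// derive_id /GRing.scale/= mulr1.
apply: (incr_derive1_ge0_itv (b0 := false) (b1 := true) (a := a) (b := b)).
- by move=> x xab; apply: dg; rewrite inE in xab.
- move=> x y xab yab xy; rewrite !fctE /=.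
  by rewrite ler_ltD// ?fh// ?ltW// /GRing.scale/= ltr_pM2l.
- by [].
Qed.

Lemma bowl_shaped_derive1_ge0 (L : R -> R) (t : R) :
  bowl_shaped_loss L -> 1 < t -> 0 <= derive1 L t.
Proof.
move=> [dL _ _ Li] t1.
apply: (nondecreasing_derive1_ge0 (a := 1) (b := t + 1)).
- by move=> x; rewrite in_itv/= => /andP[x1 _]; apply: dL; exact: lt_trans x1.
- move=> x y; rewrite !in_itv/= => /andP[x1 _] _; apply: Li; exact: ltW.
- by rewrite in_itv/= t1 ltrDl ltr01.
Qed.

Lemma bowl_shaped_derive1_le0 (L : R -> R) (t : R) :
  bowl_shaped_loss L -> 0 < t < 1 -> derive1 L t <= 0.
Proof.
move=> [dL _ Ld _] /andP[t0 t1].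
have dLt : derivable L t 1 by exact: dL.
rewrite -oppr_ge0; have <- : derive1 (- L) t = - derive1 L t.
  by rewrite !derive1E deriveN.
apply: (nondecreasing_derive1_ge0 (a := 0) (b := 1)).
- move=> x; rewrite in_itv/= => /andP[x0 _]; apply: derivableN; exact: dL.
- move=> x y; rewrite !in_itv/= => /andP[x0 _] /andP[_ y1] xy.
  rewrite lerN2; apply: Ld => //; exact: ltW.
- by rewrite in_itv/= t0.
Qed.

Lemma bowl_shaped_ge0 (L : R -> R) (t : R) :
  bowl_shaped_loss L -> 0 < t -> 0 <= L t.
Proof.
move=> [_ L1 Ld Li] t0; have [t1|t1] := leP t 1.
  by rewrite -L1; exact: Ld.
by rewrite -L1; apply: Li => //; exact: ltW.
Qed.

End monotone_derivative.

(** * The single-crossing inequality *)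

Section single_crossing.
Context (R : realType).
Local Notation mu := (@lebesgue_measure R).

(** [G x] and [w x - w x0] are both nonpositive before [x0] and both nonnegative after it, so their
    product is nonnegative; it is integrated against [p]. *)
Lemma single_crossing_integral (G p q w : R -> R) (x0 : R) : (0 < x0)%R ->
  (forall x, 0 < x < x0 -> G x <= 0)%R -> (forall x, x0 < x -> 0 <= G x)%R ->
  (forall x, 0 < x -> 0 <= p x)%R ->
  (forall x, 0 < x -> q x = w x * p x)%R ->
  (forall x y, 0 < x -> x <= y -> w x <= w y)%R ->
  mu.-integrable `]0%R, +oo[ (fun x => (G x * p x)%:E) ->
  mu.-integrable `]0%R, +oo[ (fun x => (G x * q x)%:E) ->
  (w x0)%:E * \int[mu]_(x in `]0%R, +oo[) (G x * p x)%:E <=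
  \int[mu]_(x in `]0%R, +oo[) (G x * q x)%:E.
Proof.
move=> x00 Gle0 Gge0 p0 qE wh ip iq.
have mD : measurable (`]0%R, +oo[ : set R) by exact: measurable_itv.
rewrite -(@integralZl _ _ _ mu _ mD _ ip).
apply: le_integral => //; first exact: integrableZl.
move=> x; rewrite inE/= in_itv/= andbT => xpos.
rewrite -EFinM lee_fin qE// [in leRHS]mulrCA.
have := p0 x xpos.
have [xx0|xx0|->//] := ltgtP x x0.
- have := Gle0 x; rewrite xpos xx0 => /(_ isT) Gx px.
  by apply: ler_wnM2r; [exact: mulr_le0_ge0|exact: wh (ltW xx0)].
- have := Gge0 x xx0 => Gx px.
  by apply: ler_wpM2r; [exact: mulr_ge0|exact: wh (ltW xx0)].
Qed.

End single_crossing.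

(** * Gamma and exponential order-statistic densities *)

Section gamma_density.
Context (R : realType).
Local Notation mu := (@lebesgue_measure R).
Local Open Scope ring_scope.

Lemma gamma_pdf_ge0 (k : nat) (s x : R) : 0 < s -> 0 <= gamma_pdf k s x.
Proof.
move=> s0; rewrite /gamma_pdf; case: ifP => // x0.
by rewrite divr_ge0// ?mulr_ge0 ?exprn_ge0 ?expR_ge0 ?ltW.
Qed.

Lemma measurable_gamma_pdf (k : nat) (s : R) :
  measurable_fun setT (gamma_pdf k s).
Proof.
apply: measurable_fun_ifT => //; first exact: measurable_fun_ltr.
apply: measurable_funM => //; apply: measurable_funM.
  exact: measurable_funX.
apply: measurableT_comp => //; apply: measurableT_comp => //.
exact: measurable_funM.
Qed.

Lemma gamma_pdf1_scale (k : nat) (r x : R) : 0 < r -> 0 < x ->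
  gamma_pdf k 1 (r * x) =
  r ^+ k.-1 * (x ^+ k.-1 * expR (- (r * x)) / (k.-1)`!%:R).
Proof.
move=> r0 x0; rewrite /gamma_pdf pmulr_rgt0// x0 divr1 expr1n mulr1 exprMn.
by rewrite !mulrA.
Qed.

Lemma exp_order_stat_pdf_ge0 (n a : nat) (m s x : R) : 0 < s ->
  0 <= exp_order_stat_pdf n a m s x.
Proof.
move=> s0; rewrite /exp_order_stat_pdf; case: ifP => // mx.
have h : 0 <= 1 - expR (- ((x - m) / s)).
  by rewrite subr_ge0 expR_le1 oppr_le0 divr_ge0 ?ltW// subr_gt0.
by rewrite !mulr_ge0 ?invr_ge0 ?mulr_ge0 ?exprn_ge0 ?expR_ge0 ?(ltW s0).
Qed.

Lemma exp_order_stat_pdf_gt0 (n a : nat) (m s x : R) : 0 < s -> m < x ->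
  0 < exp_order_stat_pdf n a m s x.
Proof.
move=> s0 mx; rewrite /exp_order_stat_pdf mx.
have h : 0 < 1 - expR (- ((x - m) / s)).
  by rewrite subr_gt0 expR_lt1 oppr_lt0 divr_gt0// subr_gt0.
by rewrite !(mulr_gt0, invr_gt0, exprn_gt0, expR_gt0)// ltr0n fact_gt0.
Qed.

Lemma measurable_exp_order_stat_pdf (n a : nat) (m s : R) :
  measurable_fun setT (exp_order_stat_pdf n a m s).
Proof.
have mE : measurable_fun setT (fun x : R => expR (- ((x - m) / s))).
  apply: measurableT_comp => //; apply: measurableT_comp => //.
  by apply: measurable_funM => //; exact: measurable_funB.
apply: measurable_fun_ifT => //; first exact: measurable_fun_ltr.
apply: measurable_funM; last exact: measurable_funX.
apply: measurable_funM => //; apply: measurable_funM => //.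
by apply: measurable_funX; exact: measurable_funB.
Qed.

(* Tilting by the exponential rate removes the decreasing factor of the
   density. *)
Lemma exp_order_stat_pdf_tilt_homo (n a : nat) (m s x y : R) :
  0 < s -> x <= y ->
  exp_order_stat_pdf n a m s x * expR ((n - a + 1)%:R * x / s) <=
  exp_order_stat_pdf n a m s y * expR ((n - a + 1)%:R * y / s).
Proof.
move=> s0 xy.
have tiltE z : m < z -> exp_order_stat_pdf n a m s z *
    expR ((n - a + 1)%:R * z / s) =
    n`!%:R / ((a.-1)`!%:R * (n - a)`!%:R) * s^-1 *
    expR ((n - a + 1)%:R * m / s) * (1 - expR (- ((z - m) / s))) ^+ a.-1.
  move=> mz; rewrite /exp_order_stat_pdf mz.
  have -> : expR ((n - a + 1)%:R * z / s) =
      expR ((n - a + 1)%:R * m / s) * expR ((z - m) / s) ^+ (n - a + 1).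
    rewrite -expRM_natl -expRD; congr expR; field; exact: lt0r_neq0.
  have : expR (- ((z - m) / s)) ^+ (n - a + 1) *
      expR ((z - m) / s) ^+ (n - a + 1) = 1.
    by rewrite -exprMn -expRD addNr expR0 expr1n.
  move: (_ ^+ (n - a + 1)) (_ ^+ (n - a + 1)) => u v uv.
  rewrite -[RHS]mulr1 -uv; ring.
(* For [x <= m] the density at [x] is 0, and only nonnegativity of the right-hand side is left. *)
have [mx|xm] := ltP m x; last first.
  rewrite {1}/exp_order_stat_pdf ltNge xm/= mul0r.
  by rewrite mulr_ge0 ?expR_ge0// exp_order_stat_pdf_ge0.
rewrite !tiltE//; last exact: lt_le_trans xy.
apply: ler_wpM2l.
  by rewrite !mulr_ge0// ?expR_ge0// ?invr_ge0// ?ltW.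
have h z : m < z -> 0 <= 1 - expR (- ((z - m) / s)).
  by move=> mz; rewrite subr_ge0 expR_le1 oppr_le0 divr_ge0 ?ltW// subr_gt0.
apply: lerXn2r; rewrite ?nnegrE ?h//; first exact: lt_le_trans xy.
by rewrite lerD2l lerN2 ler_expR lerN2 ler_pM2r ?invr_gt0// lerD2r.
Qed.

End gamma_density.

(** * Lower bound for the derivative of the conditional risk *)

Section conditional_risk.
Context (R : realType).
Local Notation mu := (@lebesgue_measure R).
Local Open Scope ring_scope.

(** Substituting [r * x], with [r = beta / beta1], turns the root equation for [beta1] into the
    vanishing of the integral of [derive1 L (x * beta)] against [gamma_pdf k 1 (r * x)]. Both
    integrals then share the sign change at [beta^-1], and single crossing compares them. *)
Lemma gamma_expectation_derive1_ge0 (k : nat) (L : R -> R) (beta1 beta : R) :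
  bowl_shaped_loss L ->
  (forall b, 0 < b -> mu.-integrable `]0, +oo[
    (fun y => (derive1 L (y * b) * gamma_pdf k 1 y)%:E)) ->
  0 < beta1 -> beta1 <= beta ->
  gamma_expectation k 1 (fun y => derive1 L (y * beta1)) = 0%E ->
  (0 <= gamma_expectation k 1 (fun y => derive1 L (y * beta)))%E.
Proof.
move=> hL hi b10 b1b E0.
have b0 : 0 < beta by exact: lt_le_trans b1b.
pose r := beta / beta1.
have r0 : 0 < r by exact: divr_gt0.
have r1 : 1 <= r by rewrite ler_pdivlMr// mul1r.
pose h y := (derive1 L (y * beta1) * gamma_pdf k 1 y)%:E.
have hrE x : h (r * x) = (derive1 L (x * beta) * gamma_pdf k 1 (r * x))%:E.
  congr (derive1 L _ * _)%:E; rewrite /r; field; exact: lt0r_neq0.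
have ih : mu.-integrable `]0, +oo[
    (fun y => (derive1 L (y * beta) * gamma_pdf k 1 (r * y))%:E).
  have := integrable_scale r0 (hi _ b10).
  by apply: eq_integrable => // x _; exact: hrE.
(* [w] is the ratio of [gamma_pdf k 1 x] to [gamma_pdf k 1 (r * x)], nondecreasing because
   [1 <= r]. *)
pose w x := (r ^+ k.-1)^-1 * expR ((r - 1) * x).
have := @single_crossing_integral R (fun y => derive1 L (y * beta))
  (fun y => gamma_pdf k 1 (r * y)) (gamma_pdf k 1) w beta^-1.
have -> : (\int[mu]_(x in `]0%R, +oo[)
    (derive1 L (x * beta) * gamma_pdf k 1 (r * x))%:E = 0)%E.
  move: E0; rewrite /gamma_expectation (integral_scale r0 (hi _ b10)) => /eqP.
  rewrite mule_eq0 eqe (gt_eqF r0)/= => /eqP <-.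
  by apply: eq_integral => x _; rewrite -hrE.
rewrite mule0; apply => //.
- by rewrite invr_gt0.
- move=> x /andP[x0 xb]; apply: bowl_shaped_derive1_le0 => //.
  by rewrite mulr_gt0//= -ltr_pdivlMr// div1r.
- move=> x xb; apply: bowl_shaped_derive1_ge0 => //.
  by rewrite -ltr_pdivrMr// div1r.
- by move=> x x0; exact: gamma_pdf_ge0.
- move=> x x0; rewrite gamma_pdf1_scale// /w.
  rewrite /gamma_pdf x0 divr1 expr1n mulr1.
  have -> : expR (- x) = expR ((r - 1) * x) * expR (- (r * x)).
    by rewrite -expRD; congr expR; ring.
  have rk : r ^+ k.-1 != 0 by rewrite lt0r_neq0// exprn_gt0.
  field; rewrite rk andbT pnatr_eq0 -lt0n fact_gt0//.
- move=> x y x0 xy; apply: ler_wpM2l.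
    by rewrite invr_ge0 exprn_ge0 ?(ltW r0).
  by rewrite ler_expR ler_wpM2l// subr_ge0.
- exact: hi.
Qed.

(** The positivity clause for [w0] serves the strict comparison: [w0] contains the order-statistic
    density at one point, which may vanish when [loc1 theta] is positive. *)
Lemma ratio_pdf_derive_ge (a1 b1 n1 a2 b2 : nat) (L : R -> R) (theta : param R)
    (z1 z2 c : R) (W := 1 + z1 + (n1 - a1 + 1)%:R * z2)
    (k := ((b1 + b2) - (a1 + a2) + 2)%N) :
  (a1 < b1)%N -> (a2 < b2)%N -> bowl_shaped_loss L -> admissible theta ->
  0 < z1 -> 0 < z2 -> 0 < c ->
  mu.-integrable `]0, +oo[
    (fun v => (derive1 L (c * v / scale1 theta) * (v / scale1 theta) *
      ratio_pdf a1 b1 n1 a2 b2 theta z1 z2 v)%:E) ->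
  mu.-integrable `]0, +oo[
    (fun y => (derive1 L (y * (c / W)) * gamma_pdf k 1 y)%:E) ->
  exists w0 : R, [/\ 0 <= w0, loc1 theta <= 0 -> 0 < w0 &
   (w0%:E * gamma_expectation k 1 (fun y => derive1 L (y * (c / W))) <=
   \int[mu]_(v in `]0%R, +oo[)
     (derive1 L (c * v / scale1 theta) * (v / scale1 theta) *
      ratio_pdf a1 b1 n1 a2 b2 theta z1 z2 v)%:E)%E].
Proof.
move=> ab1 ab2 hL /andP[].
case: theta => m1 m2 s1 s2 /= s10 s12 z10 z20 c0 iq ig.
have s20 : 0 < s2 by exact: lt_le_trans s12.
have W0 : 0 < W.
  by rewrite !addr_gt0// mulr_gt0// ltr0n addn1.
pose r := W / s1.
have r0 : 0 < r by exact: divr_gt0.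
pose h y := (derive1 L (y * (c / W)) * gamma_pdf k 1 y)%:E.
have hrE x : h (r * x) = (derive1 L (c * x / s1) * gamma_pdf k 1 (r * x))%:E.
  by congr (derive1 L _ * _)%:E; rewrite /r; field; rewrite !lt0r_neq0.
have ih : mu.-integrable `]0, +oo[
    (fun y => (derive1 L (c * y / s1) * gamma_pdf k 1 (r * y))%:E).
  have := integrable_scale r0 ig.
  by apply: eq_integrable => // x _; exact: hrE.
pose i := (b1 - a1).-1; pose j := (b2 - a2).-1.
(* The powers of [v] are 2 from the Jacobian, 1 from [v / s1], and [i] and [j] from the gamma
   densities; together they give the exponent of a gamma density of shape [k]. *)
have kE : k.-1 = (i + j + 3)%N by clear -ab1 ab2; rewrite /k /i /j; lia.
(* [K] collects the factors free of [v] in [v / s1] and in the two gamma densities; its last factor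
   cancels the constants of [gamma_pdf k 1 (r * v)]. *)
pose K := s1^-1 * (i`!%:R * s1 ^+ i.+1)^-1 *
  (z1 ^+ j / (j`!%:R * s2 ^+ j.+1)) * ((k.-1)`!%:R / r ^+ k.-1).
have K0 : 0 < K.
  by rewrite !(mulr_gt0, invr_gt0, exprn_gt0)// ltr0n fact_gt0.
pose N : R := (n1 - a1 + 1)%:R.
(* The tilted order-statistic density and the last exponential are both nondecreasing in [v], the
   latter because [s1 <= s2]. *)
pose w v := K * (exp_order_stat_pdf n1 a1 m1 s1 (z2 * v) *
  expR (N * (z2 * v) / s1)) * expR (z1 * v * (s1^-1 - s2^-1)).
have fge0 v : 0 <= K * (exp_order_stat_pdf n1 a1 m1 s1 (z2 * v) *
    expR (N * (z2 * v) / s1)).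
  apply: mulr_ge0; first exact: ltW.
  by rewrite mulr_ge0 ?expR_ge0 ?exp_order_stat_pdf_ge0.
(* [s1 / c] is where [derive1 L (c * v / s1)] changes sign; dividing by [r] compensates for the
   substitution [y = r * v]. *)
exists (w (s1 / c) / r); split.
- by rewrite divr_ge0 ?(ltW r0)// mulr_ge0 ?expR_ge0 ?fge0.
- move=> m10; rewrite divr_gt0// mulr_gt0 ?expR_gt0// mulr_gt0//.
  rewrite mulr_gt0 ?expR_gt0//.
  apply: exp_order_stat_pdf_gt0 => //; apply: (le_lt_trans m10).
  by rewrite mulr_gt0// divr_gt0.
have -> : gamma_expectation k 1 (fun y => derive1 L (y * (c / W))) =
    (r%:E * \int[mu]_(x in `]0%R, +oo[)
    (derive1 L (c * x / s1) * gamma_pdf k 1 (r * x))%:E)%E.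
  transitivity (r%:E * \int[mu]_(x in `]0%R, +oo[) h (r * x)%R)%E.
    exact: integral_scale r0 ig.
  apply: (congr1 (fun I => r%:E * I)%E).
  by apply: eq_integral => x _; rewrite -hrE.
rewrite muleA -EFinM divfK ?lt0r_neq0//.
under [leRHS]eq_integral do rewrite -mulrA.
apply: (@single_crossing_integral R (fun v => derive1 L (c * v / s1))
  (fun v => gamma_pdf k 1 (r * v))
  (fun v => v / s1 * ratio_pdf a1 b1 n1 a2 b2 (Param m1 m2 s1 s2) z1 z2 v)
   w (s1 / c)) => //.
- by rewrite divr_gt0.
- move=> x /andP[x0 xb]; apply: bowl_shaped_derive1_le0 => //.
  by rewrite divr_gt0 ?mulr_gt0//= ltr_pdivrMr// mul1r mulrC -ltr_pdivlMr.
- move=> x xb; apply: bowl_shaped_derive1_ge0 => //.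
  by rewrite ltr_pdivlMr// mul1r mulrC -ltr_pdivrMr.
- by move=> x x0; exact: gamma_pdf_ge0.
- move=> v v0; rewrite gamma_pdf1_scale// /w /ratio_pdf /=.
  rewrite /gamma_pdf v0 mulr_gt0//.
  have -> : (b1 - a1 = i.+1)%N by clear -ab1; rewrite /i; lia.
  have -> : (b2 - a2 = j.+1)%N by clear -ab2; rewrite /j; lia.
  (* The rate [r] of the target gamma density exceeds the rate [s1^-1 + z1 / s2] of the two gamma
     factors; the two exponential tilts in [w] make up exactly this excess. *)
  have eE : expR (- (v / s1)) * expR (- (z1 * v / s2)) =
      expR (N * (z2 * v) / s1) * expR (z1 * v * (s1^-1 - s2^-1)) *
      expR (- (r * v)).
    rewrite -!expRD; congr expR; rewrite /r /W -/N; field.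
    by rewrite !lt0r_neq0.
  move: eE; move: (expR (- (v / s1))) (expR (- (z1 * v / s2)))
    (expR (N * (z2 * v) / s1)) (expR (z1 * v * (s1^-1 - s2^-1)))
    (expR (- (r * v))) (exp_order_stat_pdf _ _ _ _ _) => e1 e2 e3 e4 e5 f eE.
  transitivity (e1 * e2 * (s1^-1 * (i`!%:R * s1 ^+ i.+1)^-1 *
    (z1 ^+ j / (j`!%:R * s2 ^+ j.+1))) * f * v ^+ (i + j + 3)).
    rewrite /= !exprD exprMn.
    ring.
  rewrite eE /K kE.
  field.
  by rewrite !lt0r_neq0 ?exprn_gt0 ?ltr0n ?fact_gt0.
- move=> x y x0 xy; apply: ler_pM.
  + exact: fge0.
  + exact: expR_ge0.
  + rewrite ler_pM2l//; apply: exp_order_stat_pdf_tilt_homo => //.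
    by rewrite ler_pM2l.
  + by rewrite ler_expR ler_wpM2r ?subr_ge0 ?lef_pV2 ?posrE// ler_pM2l.
- by move: iq; apply: eq_integrable => // x _; rewrite mulrA.
Qed.

End conditional_risk.

(** * Monotonicity of the conditional risk in the multiplier *)

Section conditional_risk_comparison.
Context (R : realType).
Local Notation mu := (@lebesgue_measure R).
Local Open Scope ring_scope.

(** The mean value theorem for the risk as a function of the multiplier; integrability allows the
    passage between real and extended integrals. *)
Lemma diff_under_integral_mono (L : R -> R) (s : R) (f : R -> R) (c c' : R) :
  diff_under_integral L s f -> 0 < c -> c < c' ->
  exists2 x : R, c < x < c' &
    ((\int[mu]_(v in `]0%R, +oo[) (L (c' * v / s) * f v)%:E) -
    \int[mu]_(v in `]0%R, +oo[) (L (c * v / s) * f v)%:E =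
    (c' - c)%:E * \int[mu]_(v in `]0%R, +oo[)
       (derive1 L (x * v / s) * (v / s) * f v)%:E)%E.
Proof.
move=> hd c0 cc'.
have mD : measurable (`]0%R, +oo[ : set R) by exact: measurable_itv.
have pos x : x \in `[c, c'] -> 0 < x.
  by rewrite in_itv/= => /andP[cx _]; exact: lt_le_trans cx.
have c'0 : 0 < c' by exact: lt_trans cc'.
have [x xcc' E] : exists2 x, x \in `]c, c'[ &
    \int[mu]_(v in `]0, +oo[) (L (c' * v / s) * f v) -
    \int[mu]_(v in `]0, +oo[) (L (c * v / s) * f v) =
    (\int[mu]_(v in `]0, +oo[) (derive1 L (x * v / s) * (v / s) * f v)) *
      (c' - c).
  apply: (@MVT R
    (fun x => \int[mu]_(v in `]0, +oo[) (L (x * v / s) * f v))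
    (fun x => \int[mu]_(v in `]0, +oo[)
      (derive1 L (x * v / s) * (v / s) * f v))) => //.
  - move=> x xc; by have [] := hd x (pos _ (subset_itv_oo_cc xc)).
  - apply: derivable_within_continuous => x xc.
    by have [_ _ /@ex_derive] := hd x (pos _ xc).
have fin y : 0 < y -> (\int[mu]_(v in `]0%R, +oo[) (L (y * v / s) * f v)%:E)%E =
     (\int[mu]_(v in `]0, +oo[) (L (y * v / s) * f v))%:E.
  move=> y0; rewrite /Rintegral fineK//.
  by have [i _ _] := hd y y0; exact: (@integrable_fin_num _ _ _ mu _ mD _ i).
exists x; first by rewrite in_itv/= in xcc'.
have x0 : 0 < x by apply: pos; exact: subset_itv_oo_cc xcc'.
rewrite !fin// -EFinB E mulrC EFinM; congr (_ * _)%E.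
rewrite /Rintegral fineK//.
by have [_ i _] := hd x x0; exact: (@integrable_fin_num _ _ _ mu _ mD _ i).
Qed.

Section ratio.
Context (a1 b1 n1 a2 b2 : nat) (L : R -> R) (theta : param R) (z1 z2 beta1 : R).
Let W := 1 + z1 + (n1 - a1 + 1)%:R * z2.
Let k := ((b1 + b2) - (a1 + a2) + 2)%N.
Let s := scale1 theta.
Let f := ratio_pdf a1 b1 n1 a2 b2 theta z1 z2.
Hypotheses (ab1 : (a1 < b1)%N) (ab2 : (a2 < b2)%N).
Hypotheses (hL : bowl_shaped_loss L) (htheta : admissible theta).
Hypotheses (z10 : 0 < z1) (z20 : 0 < z2) (beta10 : 0 < beta1).
Hypothesis hd : diff_under_integral L s f.
Hypothesis hi : forall b, 0 < b -> mu.-integrable `]0, +oo[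
    (fun y => (derive1 L (y * b) * gamma_pdf k 1 y)%:E).
Hypothesis hbeta1 : is_stein_const a1 b1 a2 b2 L beta1.

Let GE0 : gamma_expectation k 1 (fun y => derive1 L (y * beta1)) = 0%E.
Proof. by have [[]] := hbeta1. Qed.

Let W0 : 0 < W.
Proof. by rewrite !addr_gt0// mulr_gt0// ltr0n addn1. Qed.

(** The bound is kept as a product because only one factor is always positive: [r], a gamma
    expectation, is so by uniqueness of [beta1], while the weight [w0] may vanish. *)
Let cond_risk_derive c : beta1 * W < c -> exists w0 r : R,
  [/\ 0 <= w0, loc1 theta <= 0 -> 0 < w0, 0 < r &
   ((w0 * r)%:E <= \int[mu]_(v in `]0%R, +oo[)
     (derive1 L (c * v / s) * (v / s) * f v)%:E)%E].
Proof.
move=> bc; have c0 : 0 < c by apply: lt_trans bc; exact: mulr_gt0.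
have bcW : beta1 < c / W by rewrite ltr_pdivlMr.
have cW0 : 0 < c / W by exact: divr_gt0.
have [_ i _] := hd c0.
have [w0 [w00 w0p wle]] :=
  ratio_pdf_derive_ge ab1 ab2 hL htheta z10 z20 c0 i (hi cW0).
have := gamma_expectation_derive1_ge0 hL hi beta10 (ltW bcW) GE0.
rewrite le_eqVlt => /orP[/eqP GE|GE].
  (* A zero expectation would make [c / W] a second root, beyond [beta1]. *)
  have [_ /(_ (c / W))] := hbeta1.
  by move=> /(_ (conj cW0 (esym GE))) bE; rewrite bE ltxx in bcW.
have mD : measurable (`]0%R, +oo[ : set R) by exact: measurable_itv.
have GEfin :
    gamma_expectation k 1 (fun y => derive1 L (y * (c / W))) \is a fin_num.
  exact: (@integrable_fin_num _ _ _ mu _ mD _ (hi cW0)).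
exists w0, (fine (gamma_expectation k 1 (fun y => derive1 L (y * (c / W))))).
split => //; first by rewrite fine_gt0// GE ltey_eq GEfin.
by rewrite EFinM fineK.
Qed.

Lemma conditional_risk_le c : beta1 * W <= c ->
  (\int[mu]_(v in `]0%R, +oo[) (L (beta1 * W * v / s) * f v)%:E <=
   \int[mu]_(v in `]0%R, +oo[) (L (c * v / s) * f v)%:E)%E.
Proof.
rewrite le_eqVlt => /orP[/eqP <-//|bc].
have bW0 : 0 < beta1 * W by exact: mulr_gt0.
have [x /andP[bx xc] E] := diff_under_integral_mono hd bW0 bc.
rewrite -sube_ge0; last first.
  have [i _ _] := hd bW0; apply/orP; left.
  have mD : measurable (`]0%R, +oo[ : set R) by exact: measurable_itv.
  exact: (@integrable_fin_num _ _ _ mu _ mD _ i).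
have [w0 [r [w00 _ r0 wr]]] := cond_risk_derive bx.
rewrite E mule_ge0 ?lee_fin ?subr_ge0 ?(ltW bc)//.
by apply: le_trans wr; rewrite lee_fin mulr_ge0// ltW.
Qed.

(** With [loc1 theta <= 0] the order-statistic density is positive on the positive half-line, so the
    derivative at the intermediate point is positive. *)
Lemma conditional_risk_lt c : loc1 theta <= 0 -> beta1 * W < c ->
  (\int[mu]_(v in `]0%R, +oo[) (L (beta1 * W * v / s) * f v)%:E <
   \int[mu]_(v in `]0%R, +oo[) (L (c * v / s) * f v)%:E)%E.
Proof.
move=> l0 bc.
have bW0 : 0 < beta1 * W by exact: mulr_gt0.
have [x /andP[bx xc] E] := diff_under_integral_mono hd bW0 bc.
rewrite -sube_gt0.
have [w0 [r [_ /(_ l0) w00 r0 wr]]] := cond_risk_derive bx.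
rewrite E mule_gt0 ?lte_fin ?subr_gt0//.
by apply: lt_le_trans wr; rewrite lte_fin mulr_gt0.
Qed.

End ratio.

End conditional_risk_comparison.

(** * Joint law of the two ratios and [V1] *)

Section ratio_transform.
Context (R : realType).
Local Notation mu := (@lebesgue_measure R).

Lemma measurable_inv : measurable_fun setT (@GRing.inv R).
Proof.
have m0 : measurable (~` [set 0%R] : set R) by exact: measurableC.
rewrite -(setvU [set 0%R]); apply/measurable_funU => //; split.
  apply: open_continuous_measurable_fun.
    apply: closed_openC.
    exact: accessible_closed_set1 (hausdorff_accessible _) _.
  by move=> x; rewrite inE/= => /eqP x0; exact: inv_continuous.
exact: measurable_fun_set1.
Qed.

Lemma measurable_funV d (T : measurableType d) (f : T -> R) :
  measurable_fun setT f -> measurable_fun setT (fun x => (f x)^-1)%R.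
Proof. by move=> mf; exact: (measurableT_comp measurable_inv). Qed.

(** Triples are ordered as [((z2, z1), v)], matching [((X1 / V1, V2 / V1), V1)]. *)
Lemma measurable_ratio_pdf (a1 b1 n1 a2 b2 : nat) (theta : param R) :
  measurable_fun setT (fun q : R * R * R =>
    ratio_pdf a1 b1 n1 a2 b2 theta q.1.2 q.1.1 q.2).
Proof.
have m11 : measurable_fun setT (fun q : R * R * R => q.1.1).
  exact: measurableT_comp.
have m12 : measurable_fun setT (fun q : R * R * R => q.1.2).
  exact: measurableT_comp.
apply: measurable_funM; [apply: measurable_funM; [apply: measurable_funM|]|].
- exact: measurable_funX.
- apply: (measurableT_comp (measurable_exp_order_stat_pdf _ _ _ _)).
  exact: measurable_funM.
- exact: (measurableT_comp (measurable_gamma_pdf _ _)).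
- apply: (measurableT_comp (measurable_gamma_pdf _ _)).
  exact: measurable_funM.
Qed.

Lemma ratio_pdf_ge0 (a1 b1 n1 a2 b2 : nat) (theta : param R) (z1 z2 v : R) :
  admissible theta -> (0 <= ratio_pdf a1 b1 n1 a2 b2 theta z1 z2 v)%R.
Proof.
move=> /andP[s10 s12]; have s20 := lt_le_trans s10 s12.
rewrite /ratio_pdf; apply: mulr_ge0; last exact: gamma_pdf_ge0.
apply: mulr_ge0; last exact: gamma_pdf_ge0.
by rewrite mulr_ge0 ?sqr_ge0 ?exp_order_stat_pdf_ge0.
Qed.

(* [lebesgue_measure] lives on [measurableTypeR R], whose structure is not
   convertible to the one of [R]. *)
Definition borel d (T : measurableType d) (X : {mfun T >-> R}) :
    {mfun T >-> measurableTypeR R} :=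
  HB.pack (X : T -> measurableTypeR R)
    (isMeasurableFun.Build _ _ T (measurableTypeR R) X (measurable_funPT X)).

(** By independence [(X1, V2, V1)] has a product density. At each fixed [v > 0] the first two
    variables are rescaled by [v], and the factor [v ^+ 2] this produces is the Jacobian in
    [ratio_pdf]. *)
Lemma ge0_integral_ratios d (T : measurableType d)
    (a1 b1 n1 a2 b2 n2 : nat) (P : param R -> probability T R)
    (X1 X2 V1 V2 : {mfun T >-> R}) (theta : param R)
    (H : R * R * R -> \bar R) :
  censored_model a1 b1 n1 a2 b2 n2 P X1 X2 V1 V2 -> admissible theta ->
  measurable_fun setT H -> (forall q, 0 <= H q) ->
  \int[P theta]_w H (X1 w / V1 w, V2 w / V1 w, V1 w)%R =
  \int[sigma_finite_product mu mu]_z \int[mu]_v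
    (H (z, v) * (ratio_pdf a1 b1 n1 a2 b2 theta z.2 z.1 v)%:E).
Proof.
move=> hmodel htheta mH H0.
have /andP[s10 s12] := htheta; have s20 := lt_le_trans s10 s12.
have [ind pX1 _ pV1 pV2] := hmodel theta htheta.
have ind3 A B C : measurable A -> measurable B -> measurable C ->
    P theta (X1 @^-1` A `&` V2 @^-1` B `&` V1 @^-1` C) =
    P theta (X1 @^-1` A) * P theta (V2 @^-1` B) * P theta (V1 @^-1` C).
  move=> mA mB mC.
  (* Leaving [X2] unconstrained reduces the independence to three variables. *)
  have := ind A setT C B mA measurableT mC mB.
  rewrite !preimage_setT setIT probability_setT mule1 => E.
  by rewrite setIAC E muleAC.
pose f := exp_order_stat_pdf n1 a1 (loc1 theta) (scale1 theta).
pose g := gamma_pdf (b2 - a2) (scale2 theta).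
pose h := gamma_pdf (b1 - a1) (scale1 theta).
have mf : measurable_fun setT f by exact: measurable_exp_order_stat_pdf.
have mg : measurable_fun setT g by exact: measurable_gamma_pdf.
have mh : measurable_fun setT h by exact: measurable_gamma_pdf.
have f0 x : (0 <= f x)%R by exact: exp_order_stat_pdf_ge0.
have g0 x : (0 <= g x)%R by exact: gamma_pdf_ge0.
have h0 x : (0 <= h x)%R by exact: gamma_pdf_ge0.
pose F (q : R * R * R) := H (q.1.1 / q.2, q.1.2 / q.2, q.2)%R.
have m11 : measurable_fun setT (fun q : R * R * R => q.1.1).
  exact: measurableT_comp.
have m12 : measurable_fun setT (fun q : R * R * R => q.1.2).
  exact: measurableT_comp.
have mV2 : measurable_fun setT (fun q : R * R * R => q.2^-1)%R.
  exact: measurable_funV.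
have mF : measurable_fun setT F.
  apply: (measurableT_comp mH); apply: measurable_fun_pair => //.
  by apply: measurable_fun_pair; exact: measurable_funM.
have F0 q : 0 <= F q by exact: H0.
transitivity (\int[P theta]_w F (X1 w, V2 w, V1 w)) => //.
have mFB : measurable_fun
    [set: measurableTypeR R * measurableTypeR R * measurableTypeR R] F by [].
transitivity (\int[distribution (P theta) (borel X1) \x
  distribution (P theta) (borel V2) \x
  distribution (P theta) (borel V1)]_q F q).
  exact: (@ge0_integral_independent3 _ _ _ (P theta) _ _ _ _ _ _
    (borel X1) (borel V2) (borel V1) ind3 F).
pose fg (z : R * R) := (f z.1 * g z.2)%R.
have mfg : measurable_fun setT fg.
  by apply: measurable_funM; exact: measurableT_comp.
have fg0 z : (0 <= fg z)%R by exact: mulr_ge0.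
pose nX1 := distribution (P theta) (borel X1).
pose nV1 := distribution (P theta) (borel V1).
pose nV2 := distribution (P theta) (borel V2).
pose lam : {sigma_finite_measure set (measurableTypeR R) -> \bar R} :=
  lebesgue_measure.
have dX1 := @ge0_integral_density _ (measurableTypeR R) R lam nX1 _ mf f0 pX1.
have dV2 := @ge0_integral_density _ (measurableTypeR R) R lam nV2 _ mg g0 pV2.
have dV1 := @ge0_integral_density _ (measurableTypeR R) R lam nV1 _ mh h0 pV1.
have dX1V2 := @ge0_integral_density_prod R _ _
  (measurableTypeR R) (measurableTypeR R) nX1 lam nV2 lam _ _
  mf f0 mg g0 dX1 dV2.
pose PX1V2 : probability (measurableTypeR R * measurableTypeR R)%type R :=
  nX1 \x nV2.
pose mu2 : {sigma_finite_measure
    set (measurableTypeR R * measurableTypeR R)%type -> \bar R} :=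
  sigma_finite_product mu mu.
rewrite (@ge0_integral_density_prod _ _ _ _ _ PX1V2 mu2
  nV1 lam _ _ mfg fg0 mh h0
  dX1V2 dV1)//.
pose p (q : R * R * R) := ratio_pdf a1 b1 n1 a2 b2 theta q.1.2 q.1.1 q.2.
pose Hp q := H q * (p q)%:E.
have mp : measurable_fun setT p by exact: measurable_ratio_pdf.
have mHp : measurable_fun setT Hp.
  by apply: emeasurable_funM => //; exact/measurable_EFinP.
have Hp0 q : 0 <= Hp q by rewrite mule_ge0// lee_fin ratio_pdf_ge0.
pose MR := measurableTypeR R.
(* Tonelli moves [v] to the outer integral, so that the change of variables is made at fixed [v]. *)
transitivity (\int[lam]_v \int[mu2]_z Hp (z, v)); last first.
  exact/esym/(@fubini_tonelli _ _ (MR * MR)%type MR R mu2 lam _ mHp Hp0).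
have mFp : measurable_fun setT (fun q : R * R * R => F q * (fg q.1 * h q.2)%:E).
  apply: emeasurable_funM => //; apply/measurable_EFinP.
  by apply: measurable_funM; exact: measurableT_comp.
have Fp0 (q : R * R * R) : 0 <= F q * (fg q.1 * h q.2)%:E.
  by rewrite mule_ge0// lee_fin mulr_ge0.
transitivity (\int[lam]_v \int[mu2]_z (F (z, v) * (fg z * h v)%:E)).
  exact: (@fubini_tonelli2 _ _ (MR * MR)%type MR R mu2 lam _ mFp Fp0).
apply: eq_integral => v _.
(* For [v <= 0] the density of [V1] annihilates both sides; only [v > 0] can be used as a scale. *)
have [v0|v0] := ltP 0%R v; last first.
  have hv : h v = 0%R by rewrite /h /gamma_pdf ltNge v0.
  by rewrite !integral0_eq// => z _;
    rewrite /Hp /p /ratio_pdf -/(h v) hv !(mulr0, mul0r) mule0.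
transitivity (\int[mu2]_z ((v ^+ 2)%:E *
    (F (v * z.1, v * z.2, v)%R *
     (fg (v * z.1, v * z.2)%R * h v)%:E))).
  apply: (@ge0_integral_scale2 _ v (fun z => F (z, v) * (fg z * h v)%:E) v0)
    => //.
  exact: (measurableT_comp mFp).
apply: eq_integral => -[x u] _ /=.
rewrite /Hp /F /p /fg /ratio_pdf /= -/f -/g -/h.
rewrite !(mulrC v) !mulfK ?lt0r_neq0// muleCA; congr (_ * _).
by rewrite -EFinM; congr EFin; ring.
Qed.

End ratio_transform.

(** * Splitting the risk according to the signs of the ratios *)

Section risk_decomposition.
Context (R : realType) d (T : measurableType d).
Context (a1 b1 n1 a2 b2 n2 : nat) (P : param R -> probability T R).
Context (X1 X2 V1 V2 : {mfun T >-> R}) (L : R -> R).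
Hypothesis hmodel : censored_model a1 b1 n1 a2 b2 n2 P X1 X2 V1 V2.
Hypothesis hL : bowl_shaped_loss L.
Local Notation mu := (@lebesgue_measure R).
Local Notation mu2 := (sigma_finite_product mu mu).

(** Cutting [L] off to 0 outside the positive reals makes it nonnegative and measurable on the whole
    line. *)
Let Lp : R -> R := L \_ `]0%R, +oo[.

Let LpE t : (0 < t)%R -> Lp t = L t.
Proof. by move=> t0; rewrite /Lp patchE mem_set//= in_itv/= t0. Qed.

Let Lp_ge0 t : (0 <= Lp t)%R.
Proof.
rewrite /Lp patchE; case: ifPn => //; rewrite inE/= in_itv/= andbT => t0.
exact: bowl_shaped_ge0.
Qed.

Let mLp : measurable_fun setT Lp.
Proof.
apply/(measurable_restrictT _ (measurable_itv _)).
apply: open_continuous_measurable_fun; first exact: interval_open.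
move=> t; rewrite inE/= in_itv/= andbT => t0.
have [dL _ _ _] := hL.
exact/differentiable_continuous/derivable1_diffP/dL.
Qed.

(* [q] stands for [((X1 / V1, V2 / V1), V1)]. *)
Let ratio_loss (s : R) (phi : R * R -> R) (q : R * R * R) : \bar R :=
  if [&& 0 < q.1.1, 0 < q.1.2 & 0 < q.2]%R
  then (Lp (phi q.1 * q.2 / s))%:E else 0.

Let ratio_loss_ge0 s phi q : 0 <= ratio_loss s phi q.
Proof. by rewrite /ratio_loss; case: ifP; rewrite ?lee_fin. Qed.

Let measurable_ratio_loss s phi : measurable_fun setT phi ->
  measurable_fun setT (ratio_loss s phi).
Proof.
move=> mphi.
have m11 : measurable_fun setT (fun q : R * R * R => q.1.1).
  exact: measurableT_comp.
have m12 : measurable_fun setT (fun q : R * R * R => q.1.2).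
  exact: measurableT_comp.
apply: measurable_fun_ifT => //.
  by do 2?apply: measurable_and; exact: measurable_fun_ltr.
apply/measurable_EFinP; apply: (measurableT_comp mLp).
apply: measurable_funM => //; apply: measurable_funM => //.
exact: measurableT_comp.
Qed.

(** The loss on the event that some ratio is not positive. It does not involve [phi], so it is
    common to the estimators compared. *)
Let rest_loss (s c : R) (w : T) : \bar R :=
  if (0 < X1 w / V1 w)%R && (0 < V2 w / V1 w)%R then 0
  else (Lp (c * V1 w / s))%:E.

(** A common form for both estimators: the minimum as [phi] gives [delta_1S2], the constant [c]
    gives [baee]. *)
Definition shrunk (phi : R * R -> R) (c : R) (w : T) : R :=
  (if (0 < V2 w / V1 w) && (0 < X1 w / V1 w)
   then phi (X1 w / V1 w, V2 w / V1 w) * V1 w else c * V1 w)%R.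

(** The conditional risk given the ratios, multiplied by their joint density. *)
Definition ratio_risk (theta : param R) (phi : R * R -> R) (z : R * R) :
    \bar R :=
  if (0 < z.1)%R && (0 < z.2)%R then
    \int[mu]_(v in `]0%R, +oo[) (L (phi z * v / scale1 theta)
      * ratio_pdf a1 b1 n1 a2 b2 theta z.2 z.1 v)%:E
  else 0.

Let V1_gt0 theta : admissible theta -> P theta (V1 @^-1` `]-oo, 0%R]) = 0.
Proof.
move=> htheta; have [_ _ _ pV1 _] := hmodel htheta.
have := pV1 `]-oo, 0%R]%classic (measurable_itv _).
rewrite /distribution /pushforward => ->.
apply: integral0_eq => x /=; rewrite in_itv/= => x0.
by rewrite /gamma_pdf ltNge x0.
Qed.

Let measurable_rest_loss s c : measurable_fun setT (rest_loss s c).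
Proof.
have mV : measurable_fun setT (fun w => (V1 w)^-1)%R by exact: measurable_funV.
apply: measurable_fun_ifT => //.
  by apply: measurable_and; apply: measurable_fun_ltr => //;
    exact: measurable_funM.
apply/measurable_EFinP; apply: (measurableT_comp mLp).
by do 2?apply: measurable_funM.
Qed.

Let rest_loss_ge0 s c w : 0 <= rest_loss s c w.
Proof. by rewrite /rest_loss; case: ifP => // _; rewrite lee_fin. Qed.

Let ratio_riskE theta (phi : R * R -> R) z : admissible theta ->
  (forall z : R * R, 0 < z.1 -> 0 < z.2 -> 0 < phi z)%R ->
  ratio_risk theta phi z = \int[mu]_v
    (ratio_loss (scale1 theta) phi (z, v) *
     (ratio_pdf a1 b1 n1 a2 b2 theta z.2 z.1 v)%:E).
Proof.
move=> /andP[s10 _] phi0; case: z => z1 z2; rewrite /ratio_risk /=.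
case: ifPn => [/andP[z10 z20]|z0].
  rewrite integral_mkcond; apply: eq_integral => v _.
  rewrite patchE mem_setE in_itv/= andbT /ratio_loss /= z10 z20/=.
  case: ifPn => v0; last by rewrite mul0e.
  by rewrite LpE ?EFinM// divr_gt0// mulr_gt0// phi0.
apply/esym/integral0_eq => v _; rewrite /ratio_loss /=.
by rewrite andbA (negPf z0) mul0e.
Qed.

Let ratio_risk_integral theta (phi : R * R -> R) : admissible theta ->
  measurable_fun setT phi ->
  (forall z : R * R, 0 < z.1 -> 0 < z.2 -> 0 < phi z)%R ->
  \int[P theta]_w ratio_loss (scale1 theta) phi
    (X1 w / V1 w, V2 w / V1 w, V1 w)%R =
  \int[mu2]_z ratio_risk theta phi z.
Proof.
move=> htheta mphi phi0.
rewrite (ge0_integral_ratios hmodel htheta) //;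
  last exact: measurable_ratio_loss.
by apply: eq_integral => z _; rewrite ratio_riskE.
Qed.

Let measurable_ratio_risk theta (phi : R * R -> R) : admissible theta ->
  measurable_fun setT phi ->
  (forall z : R * R, 0 < z.1 -> 0 < z.2 -> 0 < phi z)%R ->
  measurable_fun setT (ratio_risk theta phi).
Proof.
move=> htheta mphi phi0.
have -> : ratio_risk theta phi = fun z => \int[mu]_v
    (ratio_loss (scale1 theta) phi (z, v) *
     (ratio_pdf a1 b1 n1 a2 b2 theta z.2 z.1 v)%:E).
  by apply/funext => z; exact: ratio_riskE.
pose MR := measurableTypeR R.
apply: (@measurable_fun_fubini_tonelli_F _ _ (MR * MR)%type MR R mu
  (fun q => ratio_loss (scale1 theta) phi q *
    (ratio_pdf a1 b1 n1 a2 b2 theta q.1.2 q.1.1 q.2)%:E)).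
- apply: emeasurable_funM; first exact: measurable_ratio_loss.
  apply/measurable_EFinP; exact: measurable_ratio_pdf.
- by move=> q; rewrite mule_ge0// lee_fin ratio_pdf_ge0.
Qed.

(** Almost surely [V1 > 0], and then the signs of the ratios select one of the two summands;
    positivity of [phi] and [c] keeps the argument of [L] where it agrees with [Lp]. *)
Let riskE theta (phi : R * R -> R) c : admissible theta ->
  measurable_fun setT phi ->
  (forall z : R * R, 0 < z.1 -> 0 < z.2 -> 0 < phi z)%R -> (0 < c)%R ->
  risk P L theta (shrunk phi c) =
  \int[P theta]_w rest_loss (scale1 theta) c w +
  \int[mu2]_z ratio_risk theta phi z.
Proof.
move=> htheta mphi phi0 c0; have /andP[s10 _] := htheta.
have mV : measurable_fun setT (fun w => (V1 w)^-1)%R by exact: measurable_funV.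
rewrite -ratio_risk_integral//.
rewrite /risk unlock -ge0_integralD//; last first.
  apply: measurableT_comp; first exact: measurable_ratio_loss.
  by do 2?apply: measurable_fun_pair => //; exact: measurable_funM.
apply: (eq_integral_off_null (N := V1 @^-1` `]-oo, 0%R])).
- exact: measurable_funPTI.
- exact: V1_gt0.
move=> w /=; rewrite in_itv/= => /negP; rewrite -ltNge => Vw0.
rewrite /rest_loss /ratio_loss /shrunk /= Vw0 andbT andbC.
case: ifPn => [/andP[z10 z20]|_].
  by rewrite add0e LpE// divr_gt0// mulr_gt0// phi0.
by rewrite adde0 LpE// divr_gt0// mulr_gt0.
Qed.

Let ratio_risk_ge0 theta phi z : admissible theta ->
  (forall z : R * R, 0 < z.1 -> 0 < z.2 -> 0 < phi z)%R ->
  0 <= ratio_risk theta phi z.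
Proof.
move=> htheta phi0; rewrite ratio_riskE//; apply: integral_ge0 => v _.
by rewrite mule_ge0// lee_fin ratio_pdf_ge0.
Qed.

Lemma le_risk_shrunk theta (phi psi : R * R -> R) c : admissible theta ->
  measurable_fun setT phi -> measurable_fun setT psi ->
  (forall z : R * R, 0 < z.1 -> 0 < z.2 -> 0 < phi z)%R ->
  (forall z : R * R, 0 < z.1 -> 0 < z.2 -> 0 < psi z)%R -> (0 < c)%R ->
  (forall z, ratio_risk theta phi z <= ratio_risk theta psi z) ->
  risk P L theta (shrunk phi c) <= risk P L theta (shrunk psi c).
Proof.
move=> htheta mphi mpsi phi0 psi0 c0 le_risk.
rewrite !riskE// leeD2l//.
apply: ge0_le_integral => //.
- by move=> z _; exact: ratio_risk_ge0.
- exact: measurable_ratio_risk.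
- exact: measurable_ratio_risk.
Qed.

Lemma lt_risk_shrunk theta (phi psi : R * R -> R) c (B : set (R * R)) :
  admissible theta ->
  measurable_fun setT phi -> measurable_fun setT psi ->
  (forall z : R * R, 0 < z.1 -> 0 < z.2 -> 0 < phi z)%R ->
  (forall z : R * R, 0 < z.1 -> 0 < z.2 -> 0 < psi z)%R -> (0 < c)%R ->
  (forall z, ratio_risk theta phi z <= ratio_risk theta psi z) ->
  (forall z, ratio_risk theta phi z \is a fin_num) ->
  risk P L theta (shrunk psi c) < +oo ->
  measurable B -> mu2 B != 0 ->
  (forall z, B z -> ratio_risk theta phi z < ratio_risk theta psi z) ->
  risk P L theta (shrunk phi c) < risk P L theta (shrunk psi c).
Proof.
move=> htheta mphi mpsi phi0 psi0 c0 le_risk phifin.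
rewrite !riskE// => psifin mB B0 lt_risk.
have rest0 : 0 <= \int[P theta]_w rest_loss (scale1 theta) c w.
  exact: integral_ge0.
have ratio0 : 0 <= \int[mu2]_z ratio_risk theta psi z.
  by apply: integral_ge0 => z _; exact: ratio_risk_ge0.
(* The common term is bounded by the finite risk for [psi], so it can be cancelled from a strict
   inequality. *)
rewrite lteD2lE; last first.
  by rewrite ge0_fin_numE//; apply: le_lt_trans psifin; rewrite leeDl.
apply: (@lt_ge0_integral _ (measurableTypeR R * measurableTypeR R)%type R mu2
  _ _ B) => //.
- exact: measurable_ratio_risk.
- exact: measurable_ratio_risk.
- by move=> z; exact: ratio_risk_ge0.
- by apply: le_lt_trans psifin; rewrite leeDr.
Qed.

(** Finiteness is what the strict comparison requires; the risk is an integral against the density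
    of [V1], where the regularity hypothesis applies. *)
Lemma risk_baee_lty theta c : admissible theta -> (0 < c)%R ->
  diff_under_integral L (scale1 theta)
    (gamma_pdf (b1 - a1) (scale1 theta)) ->
  risk P L theta (baee c V1) < +oo.
Proof.
move=> htheta c0 /(_ c c0)[i _ _]; have /andP[s10 _] := htheta.
set s := scale1 theta in s10 i *.
have [_ _ _ pV1 _] := hmodel htheta.
have mG : measurable_fun setT (fun v => (Lp (c * v / s))%:E).
  apply/measurable_EFinP; apply: (measurableT_comp mLp).
  by apply: measurable_funM => //; exact: measurable_funM.
have -> : risk P L theta (baee c V1) =
    \int[P theta]_w (Lp (c * V1 w / s))%:E.
  rewrite /risk unlock.
  apply: (eq_integral_off_null (N := V1 @^-1` `]-oo, 0%R])).
  - exact: measurable_funPTI.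
  - exact: V1_gt0.
  - move=> w /=; rewrite in_itv/= => /negP; rewrite -ltNge => Vw0.
    by rewrite /baee LpE// divr_gt0// mulr_gt0.
have -> : \int[P theta]_w (Lp (c * V1 w / s))%:E =
    \int[distribution (P theta) (borel V1)]_v (Lp (c * v / s))%:E.
  by rewrite ge0_integral_pushforward// => v _; rewrite lee_fin.
pose lam : {sigma_finite_measure set (measurableTypeR R) -> \bar R} :=
  lebesgue_measure.
have g0 x : (0 <= gamma_pdf (b1 - a1) s x)%R by exact: gamma_pdf_ge0.
have -> : \int[distribution (P theta) (borel V1)]_v (Lp (c * v / s))%:E =
    \int[lam]_v ((Lp (c * v / s))%:E * (gamma_pdf (b1 - a1) s v)%:E).
  apply: (@ge0_integral_density _ (measurableTypeR R) R lam
    (distribution (P theta) (borel V1)) _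
    (measurable_gamma_pdf (b1 - a1) s) g0 pV1) => //.
  by move=> v; rewrite lee_fin.
have -> : \int[lam]_v ((Lp (c * v / s))%:E * (gamma_pdf (b1 - a1) s v)%:E) =
    \int[mu]_(v in `]0%R, +oo[) (L (c * v / s) * gamma_pdf (b1 - a1) s v)%:E.
  rewrite [RHS]integral_mkcond; apply: eq_integral => v _.
  rewrite patchE mem_setE in_itv/= andbT; case: ifPn => v0.
    by rewrite LpE ?EFinM// divr_gt0// mulr_gt0.
  by rewrite /gamma_pdf (negPf v0) mule0.
exact: (@integrable_lty _ _ _ mu _ (measurable_itv _) _ i).
Qed.

End risk_decomposition.

(** * A non-null set of ratios near the origin *)

Section positive_box.
Context (R : realType).

Lemma lebesgue_square_neq0 (e : R) : (0 < e)%R ->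
  sigma_finite_product (@lebesgue_measure R) (@lebesgue_measure R)
    (`]0%R, e[ `*` `]0%R, e[) != 0.
Proof.
move=> e0; have mI : measurable (`]0%R, e[%classic : set (measurableTypeR R)).
  exact: measurable_itv.
have -> : sigma_finite_product (@lebesgue_measure R) (@lebesgue_measure R)
    (`]0%R, e[ `*` `]0%R, e[) =
    lebesgue_measure (`]0%R, e[%classic : set R) *
    lebesgue_measure (`]0%R, e[%classic : set R).
  exact: product_measure1E.
by rewrite lebesgue_measure_itv/= lte_fin e0 oppr0 adde0 mule_eq0 !eqe gt_eqF.
Qed.

End positive_box.

(* Domination of the best affine equivariant estimator *)
Local Close Scope ereal_scope.

Theorem corollary2p4 (R : realType) (d : measure_display) (T : measurableType d)
    (a1 b1 n1 a2 b2 n2 : nat)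
    (ha1 : (1 <= a1)%N) (hab1 : (a1 < b1)%N) (hbn1 : (b1 <= n1)%N)
    (ha2 : (1 <= a2)%N) (hab2 : (a2 < b2)%N) (hbn2 : (b2 <= n2)%N)
    (P : param R -> probability T R) (X1 X2 V1 V2 : {mfun T >-> R})
    (hmodel : censored_model a1 b1 n1 a2 b2 n2 P X1 X2 V1 V2)
    (L : R -> R) (hL : bowl_shaped_loss L)
    (hreg : regular_loss a1 b1 n1 a2 b2 L)
    (c01 beta1 : R)
    (hc01 : is_baee_const a1 b1 L c01)
    (hbeta1 : is_stein_const a1 b1 a2 b2 L beta1)
    (hlt : beta1 < c01) :
  dominates P L (delta_1S2 n1 a1 c01 beta1 X1 V1 V2) (baee c01 V1).
Proof.
have [hV1 hratio hgamma] := hreg.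
have [[beta10 _] _] := hbeta1.
have c010 : 0 < c01 by exact: lt_trans hlt.
pose N : R := (n1 - a1 + 1)%:R.
(* In a pair [z] the first component stands for [X1 / V1] and the second for [V2 / V1]. *)
pose W (z : R * R) := 1 + z.2 + N * z.1.
pose phi z := Num.min c01 (beta1 * W z).
pose psi (z : R * R) := c01.
have N0 : 0 <= N by rewrite /N.
have W0 (z : R * R) : 0 < z.1 -> 0 < z.2 -> 0 < W z.
  by move=> z10 z20; rewrite ltr_wpDr ?mulr_ge0 ?(ltW z10)// addr_gt0.
have mphi : measurable_fun setT phi.
  apply: measurable_minr => //; apply: measurable_funM => //.
  apply: measurable_funD; first exact: measurable_funD.
  exact: measurable_funM.
have mpsi : measurable_fun setT psi by exact: measurable_cst.
have phi0 (z : R * R) : 0 < z.1 -> 0 < z.2 -> 0 < phi z.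
  by move=> z10 z20; rewrite lt_min c010 mulr_gt0// W0.
have psi0 (z : R * R) : 0 < z.1 -> 0 < z.2 -> 0 < psi z by [].
have baeeE : baee c01 V1 = shrunk X1 V1 V2 psi c01 :> (T -> R).
  by apply/funext => w; rewrite /baee /shrunk; case: ifP.
have deltaE : delta_1S2 n1 a1 c01 beta1 X1 V1 V2 = shrunk X1 V1 V2 phi c01.
  by [].
have le_ratio theta z : admissible theta ->
    (ratio_risk a1 b1 n1 a2 b2 L theta phi z <=
     ratio_risk a1 b1 n1 a2 b2 L theta psi z)%E.
  move=> htheta; rewrite /ratio_risk; case: ifPn => // /andP[z10 z20].
  (* Where the minimum is [c01] the two risks coincide; elsewhere [c01] lies above [beta1 * W z], on
     the range where the conditional risk increases. *)
  rewrite /phi /psi; case: (leP c01 (beta1 * W z)) => // bc.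
  by apply: conditional_risk_le => //; [exact: hratio|exact: ltW].
rewrite deltaE baeeE; split => [theta htheta|].
  apply: (le_risk_shrunk hmodel hL htheta mphi mpsi phi0 psi0 c010) => z.
  exact: le_ratio.
(* Location 0 keeps the weight positive, so the conditional comparison is strict at this
   parameter. *)
pose theta : param R := Param 0 0 1 1.
have htheta : admissible theta by rewrite /admissible /= ltr01 lexx.
exists theta; split => //.
(* Chosen so that [1 + (1 + N) * e = c01 / beta1]: on the square of side [e] this bounds [W]
   strictly, whence [beta1 * W z < c01]. *)
pose e := (c01 / beta1 - 1) / (1 + N).
have N10 : 0 < 1 + N by rewrite ltr_wpDr.
have e0 : 0 < e by rewrite divr_gt0// subr_gt0 ltr_pdivlMr// mul1r.
apply: (lt_risk_shrunk hmodel hL htheta mphi mpsi phi0 psi0 c010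
    (B := `]0, e[ `*` `]0, e[)) => //.
- by move=> z; exact: le_ratio.
- move=> z; rewrite /ratio_risk; case: ifPn => // /andP[z10 z20].
  have [i _ _] := hratio theta z.2 z.1 htheta z20 z10 (phi z) (phi0 z z10 z20).
  exact: (@integrable_fin_num _ _ _ lebesgue_measure _ (measurable_itv _) _ i).
- rewrite -baeeE; apply: (risk_baee_lty hmodel hL htheta c010).
  exact: hV1.
- exact: measurableX.
- exact: lebesgue_square_neq0.
- move=> -[x y] [] /=; rewrite !in_itv/= => /andP[x0 xe] /andP[y0 ye].
  rewrite /ratio_risk /= x0 y0 /=.
  have bc : beta1 * W (x, y) < c01.
    rewrite -ltr_pdivlMl// mulrC /W /= -addrA -ltrBrDl.
    have -> : c01 / beta1 - 1 = (1 + N) * e.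
      by rewrite [RHS]mulrC divfK// lt0r_neq0.
    rewrite mulrDl mul1r.
    by rewrite ltr_leD// ler_wpM2l// ltW.
  rewrite /phi /psi min_r ?(ltW bc)//.
  by apply: conditional_risk_lt => //; exact: hratio.
Qed.
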